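(* Let $K$ be a field, $S=K[x_1,\ldots,x_n]$, and let $d$ be an integer with $2\le d<n$. Given $\mathbf{a}=(a_1,\ldots,a_n)\in\mathbb{Z}_{>0}^n$, the ideal ${I_n(d)}^{[\mathbf{a}]}$ is componentwise linear if and only if at most one component of $\mathbf{a}$ is bigger than one.
   Context: $S=K[x_1,\ldots,x_n]$ is the polynomial ring in $n$ variables over a field $K$ with the standard grading $\deg x_1=\cdots=\deg x_n=1$. For a monomial ideal $I$ of $S$, $G(I)$ denotes its unique minimal set of monomial generators. For $2\le d<n$, the squarefree Veronese ideal of $S$ of degree $d$ is the ideal $I_n(d)$ of $S$ generated by all squarefree monomials of $S$ of degree $d$. For $\mathbf{a}=(a_1,\ldots,a_n)\in\mathbb{Z}_{>0}^n$ and a squarefree monomial $u=x_{i_1}\cdots x_{i_d}$ with $1\le i_1<\cdots<i_d\le n$, set $u^{[\mathbf{a}]}:=x_{i_1}^{a_{i_1}}\cdots x_{i_d}^{a_{i_d}}$. For a squarefree monomial ideal $I$ of $S$, $I^{[\mathbf{a}]}$ is the monomial ideal with $G(I^{[\mathbf{a}]})=\{u^{[\mathbf{a}]} : u\in G(I)\}$. For a homogeneous ideal $I$ of $S$ and an integer $j$, $I_{\langle j\rangle}$ denotes the ideal of $S$ generated by all homogeneous polynomials of degree $j$ belonging to $I$. The ideal $I$ is componentwise linear if $I_{\langle j\rangle}$ has a linear resolution for all $j$ (with the usual convention that the zero ideal has a linear resolution). An ideal $L$ generated by homogeneous elements of a single degree $d$ has a linear resolution if its graded Betti numbers satisfy $\beta_{p,q}(L)=\dim_K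 \operatorname{Tor}_p^S(K,L)_q=0$ whenever $q\ne p+d$. *)

(* Defs.v *)
From HB Require Import structures.
From mathcomp Require Import all_boot all_order all_algebra.
From mathcomp Require Export mpoly.

Set Implicit Arguments.
Unset Strict Implicit.
Unset Printing Implicit Defensive.

Import GRing.Theory.
Local Open Scope ring_scope.

Section Ideals.
Variables (K : fieldType) (n : nat).
Local Notation S := {mpoly K[n]}.

Definition ideal_gen (G : S -> Prop) (f : S) : Prop :=
  exists2 s : seq (S * S),
    forall cg, cg \in s -> G cg.2 & f = \sum_(cg <- s) cg.1 * cg.2.

Definition monomials (M : 'X_{1..n} -> Prop) (f : S) : Prop :=
  exists2 u, M u & f = 'X_[u].

Definition monomial_generators (I : S -> Prop) (M : 'X_{1..n} -> Prop) : Prop :=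
  forall f, I f <-> ideal_gen (monomials M) f.

Definition minimal_monomial_generators
    (I : S -> Prop) (M : 'X_{1..n} -> Prop) : Prop :=
  monomial_generators I M /\
  forall M' : 'X_{1..n} -> Prop, (forall u, M' u -> M u) ->
    monomial_generators I M' -> forall u, M u -> M' u.

(* G(I); a monomial ideal I has exactly one minimal set of monomial
   generators, and this predicate is that set. *)
Definition min_gens (I : S -> Prop) (u : 'X_{1..n}) : Prop :=
  exists2 M, minimal_monomial_generators I M & M u.

Definition squarefree_veronese (d : nat) : S -> Prop :=
  ideal_gen (monomials (fun u => (forall i, (u i <= 1)%N) /\ mdeg u = d)).

(* u^[a] for u squarefree: as u i is 0 or 1, the exponent u i * a i is 0
   or a i. *)
Definition mnm_pow (a : 'I_n -> nat) (u : 'X_{1..n}) : 'X_{1..n} :=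
  [multinom (u i * a i)%N | i < n].

Definition ideal_pow (a : 'I_n -> nat) (I : S -> Prop) : S -> Prop :=
  ideal_gen (monomials (fun w => exists2 u, min_gens I u & w = mnm_pow a u)).

(* I_<j> *)
Definition degree_part_ideal (I : S -> Prop) (j : nat) : S -> Prop :=
  ideal_gen (fun f => I f /\ f \is j.-homog).

Definition generated_in_degree (d : nat) (L : S -> Prop) : Prop :=
  exists2 G : S -> Prop, forall g, G g -> g \is d.-homog &
    forall f, L f <-> ideal_gen G f.

End Ideals.

Section Resolutions.
Variables (K : fieldType) (n : nat).
Local Notation S := {mpoly K[n]}.

(* The map of free modules S^B -> S^C with matrix D (acting on rows). *)
Definition free_map (B C : finType) (D : B -> C -> S) (v : {ffun B -> S}) :
    {ffun C -> S} :=
  [ffun c => \sum_b v b * D b c].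

(* The S-linear map S^B -> K = S/(x_1, ..., x_n) sending the b-th basis
   vector to e b. *)
Definition augmentation (B : finType) (e : B -> K) (v : {ffun B -> S}) : K :=
  \sum_b (v b)@_0%MM * e b.

(* f is homogeneous of degree q as an element of S(-s). Stated without
   subtraction, so that f = 0 is forced when q < s. *)
Definition shifted_homog (s q : nat) (f : S) : Prop :=
  forall m, m \in msupp f -> (mdeg m + s)%N = q.

(* ... -> F_1 -> F_0 -> K -> 0, where F_p is free of finite rank with basis
   res_basis p, the basis element b being in degree res_deg b. *)
Record graded_free_resolution := GradedFreeResolution {
  res_basis : nat -> finType;
  res_deg : forall p, res_basis p -> nat;
  res_diff : forall p, res_basis p.+1 -> res_basis p -> S;
  res_aug : res_basis 0 -> K;
  res_diff_homog : forall p (b : res_basis p.+1) (c : res_basis p),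
    shifted_homog (res_deg c) (res_deg b) (res_diff b c);
  res_aug_homog : forall b : res_basis 0, res_aug b != 0 -> res_deg b = 0%N;
  res_aug_surj : forall k : K, exists v, augmentation res_aug v = k;
  res_exact0 : forall v : {ffun res_basis 0 -> S},
    augmentation res_aug v = 0 <->
    exists w : {ffun res_basis 1 -> S}, v = free_map (@res_diff 0) w;
  res_exact : forall p (v : {ffun res_basis p.+1 -> S}),
    free_map (@res_diff p) v = 0 <->
    exists w : {ffun res_basis p.+2 -> S}, v = free_map (@res_diff p.+1) w
}.

Section Tor.
Variables (F : graded_free_resolution) (L : S -> Prop).

(* For an ideal L, F_p (x)_S L is identified with the submodule L^B of S^B,
   B the basis of F_p; this is its component of degree q. *)
Definition tensor_part (p q : nat) (v : {ffun res_basis F p -> S}) : Prop :=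
  forall b, L (v b) /\ shifted_homog (res_deg b) q (v b).

Definition tensor_cycle (p : nat) : {ffun res_basis F p -> S} -> Prop :=
  match p with
  | 0 => fun _ => True
  | p'.+1 => fun v => free_map (@res_diff F p') v = 0
  end.

Definition Tor_cycles (p q : nat) (v : {ffun res_basis F p -> S}) : Prop :=
  tensor_part q v /\ tensor_cycle v.

Definition Tor_boundaries (p q : nat) (v : {ffun res_basis F p -> S}) : Prop :=
  exists2 w : {ffun res_basis F p.+1 -> S},
    tensor_part q w & v = free_map (@res_diff F p) w.

End Tor.

End Resolutions.

(* dim_K (Z / B) = m, for subspaces B <= Z of V: the classes of the t i form
   a basis of Z / B. *)
Definition dim_quotient (K : fieldType) (V : lmodType K) (Z B : V -> Prop)
    (m : nat) : Prop :=
  exists2 t : 'I_m -> V, forall i, Z (t i) &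
    forall v, Z v -> exists! c : 'rV[K]_m, B (v - \sum_i c 0 i *: t i).

Section Koszul.
Variables (K : fieldType) (n : nat).
Local Notation S := {mpoly K[n]}.
Implicit Types (A C : {set 'I_n}) (m : 'X_{1..n}) (V : {set 'I_n} -> S).

Definition koszul_basis (p : nat) : finType := {A : {set 'I_n} | #|A| == p}.

Definition koszul_sign A (i : 'I_n) : K := (-1) ^+ #|[set k in A | (k < i)%N]|.

(* d(e_A) = \sum_(i in A) (-1)^(#{k in A | k < i}) x_i e_(A \ i) *)
Definition koszul_diff p (A : koszul_basis p.+1) (C : koszul_basis p) : S :=
  \sum_(i in val A | val A :\ i == val C) koszul_sign (val A) i *: 'X_i.

(* The differential on families indexed by all subsets, used in the proof
   of exactness together with the K-linear contracting homotopy that sends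
   x^m e_A to x^(m - U_i) e_(i |: A), where i = min (A U supp m), if i is not
   in A, and to 0 otherwise. *)
Definition koszul_d V C : S := \sum_(i | i \notin C) V (i |: C) * (koszul_sign C i *: 'X_i).

Definition least_elt A (i : 'I_n) := (i \in A) && [forall k : 'I_n, (k \in A) ==> (i <= k)%N].

Definition koszul_h V A : S :=
  if [pick i | least_elt A i] is Some i then
    \sum_(m <- msupp (V (A :\ i)))
      (if (m i != 0%N) && [forall k : 'I_n, (k < i)%N ==> (m k == 0%N)]
       then (V (A :\ i))@_m *: 'X_[m - U_(i)] else 0)
  else 0.

Lemma mcoeff_mulXU (f : S) i m :
  (f * 'X_i)@_m = if m i != 0%N then f@_(m - U_(i)) else 0.
Proof.
case: ifP => [mi|/negbFE/eqP mi].
  have le : (U_(i) <= m)%MM by rewrite lep1mP.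
  by rewrite -[in LHS](submK le) addmC mcoeffMX.
apply/eqP; rewrite mcoeff_eq0; apply: contraTN (eqxx (m i)) => /msuppM_le.
case/allpairsP=> -[m1 m2] /= [_]; rewrite msuppX inE => /eqP -> E.
by rewrite {1}E mi mnmDE mnm1E eqxx addn1.
Qed.

Lemma koszul_d_coef V C m :
  (koszul_d V C)@_m = \sum_(i | i \notin C)
    koszul_sign C i * (if m i != 0%N then (V (i |: C))@_(m - U_(i)) else 0).
Proof.
rewrite /koszul_d raddf_sum /=; apply: eq_bigr => i _.
by rewrite -scalerAr mcoeffZ mcoeff_mulXU.
Qed.

Lemma least_elt_uniq A i j : least_elt A i -> least_elt A j -> i = j.
Proof.
move=> /andP[iA /forallP mi] /andP[jA /forallP mj]; apply/val_inj/eqP => /=.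
by rewrite eqn_leq (implyP (mi j) jA) (implyP (mj i) iA).
Qed.

Lemma koszul_h_coef V A i m : least_elt A i ->
  (koszul_h V A)@_m = if [forall k : 'I_n, (k < i)%N ==> (m k == 0%N)]
                then (V (A :\ i))@_(m + U_(i)) else 0.
Proof.
move=> Ai; rewrite /koszul_h; case: pickP => [j Aj|/(_ i)]; last by rewrite Ai.
rewrite {j Aj}(least_elt_uniq Aj Ai); set f := V _; rewrite raddf_sum /=.
have cE : [forall k : 'I_n, (k < i)%N ==> (m k == 0%N)] =
   [forall k : 'I_n, (k < i)%N ==> ((m + U_(i))%MM k == 0%N)].
  apply: eq_forallb => k; case: ltnP => //= ki.
  by rewrite mnmDE mnm1E -val_eqE /= (gtn_eqF ki) addn0.
pose P (m : 'X_{1..n}) := [forall k : 'I_n, (k < i)%N ==> (m k == 0%N)].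
rewrite cE -/(P (m + U_(i))%MM).
have E m' : (if (m' i != 0%N) && [forall k : 'I_n, (k < i)%N ==> (m' k == 0%N)]
    then f@_m' *: 'X_[m' - U_(i)] else 0 : S)@_m =
    if m' == (m + U_(i))%MM then (if P (m + U_(i))%MM then f@_m' else 0) else 0.
  case: (eqVneq m' _) => [->|ne].
    rewrite mnmDE mnm1E eqxx addn1 /= -/(P _); case: ifP => _; last exact: mcoeff0.
    by rewrite addmK mcoeffZ mcoeffX eqxx mulr1.
  case: ifP => [/andP[m'i _]|_]; last exact: mcoeff0.
  rewrite mcoeffZ mcoeffX; case: eqVneq => [mE|]; last by rewrite mulr0.
  by case/eqP: ne; rewrite -mE submK // lep1mP.
rewrite (eq_bigr _ (fun m' _ => E m')) /=.
have [min|mout] := boolP ((m + U_(i))%MM \in msupp f).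
  by rewrite (bigD1_seq (m + U_(i))%MM) //= eqxx big1 ?addr0 // => m' /negbTE ->.
rewrite big1_seq => [|m' /andP[_ mi]]; last first.
  by case: eqP => // mE; rewrite -mE mi in mout.
by case: ifP => // _; apply/esym/memN_msupp_eq0.
Qed.

Lemma koszul_h0 V : koszul_h V set0 = 0.
Proof. by rewrite /koszul_h; case: pickP => // i; rewrite /least_elt in_set0. Qed.

Lemma koszul_signU C i : koszul_sign (i |: C) i = koszul_sign C i.
Proof.
congr (_ ^+ #|pred_of_set _|); apply/setP=> k; rewrite !inE.
by case: eqVneq => [->|]; rewrite ?ltnn ?andbF.
Qed.

Lemma koszul_sign_least C (i k : 'I_n) : i \in C -> (i < k)%N ->
  koszul_sign C k = - koszul_sign (C :\ i) k.
Proof.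
move=> iC ik; rewrite /koszul_sign.
have -> : [set j in C | (j < k)%N] = i |: [set j in C :\ i | (j < k)%N].
  by apply/setP=> j; rewrite !inE; case: eqVneq => [->|] //=; rewrite iC ik.
by rewrite cardsU1 !inE eqxx /= exprS mulN1r.
Qed.

Lemma koszul_sign_gt C (i k : 'I_n) : (k < i)%N ->
  koszul_sign (C :\ i) k = koszul_sign C k.
Proof.
move=> ki; congr (_ ^+ #|pred_of_set _|); apply/setP=> j; rewrite !inE.
by case: eqVneq => [->|] //=; rewrite ltnNge (ltnW ki) andbF.
Qed.

Lemma koszul_sign_min C (i : 'I_n) :
  (forall k : 'I_n, k \in C -> (i <= k)%N) -> koszul_sign C i = 1.
Proof.
move=> min; rewrite /koszul_sign (_ : [set k in C | _] = set0) ?cards0 //.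
apply/setP=> k; rewrite !inE; apply/negbTE; rewrite negb_and -leqNgt.
by case: (boolP (k \in C)) => //= /min.
Qed.

Lemma koszul_dd V C : koszul_d (koszul_d V) C = 0.
Proof.
rewrite /koszul_d; under eq_bigr => i _ do rewrite mulr_suml.
pose t (i j : 'I_n) : S := V (j |: (i |: C)) *
  (koszul_sign (i |: C) j *: 'X_j) * (koszul_sign C i *: 'X_i).
have split i : i \notin C ->
  \sum_(j | j \notin i |: C) t i j =
  \sum_(j | (j \notin C) && (j < i)%N) t i j +
  \sum_(j | (j \notin C) && (i < j)%N) t i j.
  move=> iC; rewrite (bigID (fun j : 'I_n => (j < i)%N)) /=.
  congr (_ + _); apply: eq_bigl => j; rewrite !inE negb_or -val_eqE /=.
    by case: ltngtP => //= _; rewrite ?andbT ?andbF.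
  by case: ltngtP => //= _; rewrite ?andbT ?andbF.
rewrite (eq_bigr _ (fun i iC => split i iC)) big_split /=.
rewrite (exchange_big_dep (fun j => j \notin C)) /=; last by move=> i j _ /andP[].
rewrite -big_split /= big1 // => i iC.
have -> : \sum_(i0 | (i0 \notin C) && ((i \notin C) && (i < i0)%N)) t i0 i =
          \sum_(j | (j \notin C) && (i < j)%N) t j i.
  by apply: eq_bigl => j; rewrite iC.
rewrite -big_split big1 //= => j /andP[jC ij]; rewrite /t.
have jiC : j \notin i |: C by rewrite !inE negb_or jC andbT -val_eqE /= gtn_eqF.
have -> : i |: (j |: C) = j |: (i |: C) by rewrite setUCA.
have -> : koszul_sign (j |: C) i = koszul_sign C i.
  by rewrite -(koszul_sign_gt _ ij) setU1K.
have -> : koszul_sign (i |: C) j = - koszul_sign C j.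
  by rewrite (koszul_sign_least (setU11 i C) ij) setU1K.
by rewrite scaleNr mulrN mulNr -!mulrA [X in _ * X + _]mulrC addrN.
Qed.

Lemma koszul_dh V C i m : (i \in C) || (m i != 0%N) ->
  (forall k : 'I_n, (k < i)%N -> (k \notin C) && (m k == 0%N)) ->
  (koszul_d (koszul_h V) C)@_m = (V C)@_m -
    (if i \in C then (koszul_d V (C :\ i))@_(m + U_(i)) else 0).
Proof.
move=> iCm min.
have ile (k : 'I_n) : (k \in C) || (m k != 0%N) -> (i <= k)%N.
  by rewrite leqNgt; apply: contraTN => /min /andP[/negbTE-> ->].
have lst A : i \in A -> (forall k, k \in A -> (k \in C) || (m k != 0%N)) ->
    least_elt A i.
  move=> iA sub; rewrite /least_elt iA; apply/forallP=> k; apply/implyP.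
  by move=> /sub /ile.
have sgn1 : koszul_sign C i = 1 by apply: koszul_sign_min => k kC; apply: ile; rewrite kC.
have zero k : [forall l : 'I_n, (l < i)%N ==> ((m - U_(k))%MM l == 0%N)].
  apply/forallP=> l; apply/implyP=> /min /andP[_ /eqP ml].
  by rewrite mnmBE ml.
rewrite koszul_d_coef; have [iC|iC] := boolP (i \in C); last first.
  have mi : m i != 0%N by rewrite (negbTE iC) in iCm.
  have le : (U_(i) <= m)%MM by rewrite lep1mP.
  rewrite subr0 (bigD1 i) //= big1 => [|k /andP[kC ki]].
    rewrite addr0 sgn1 mi mul1r (@koszul_h_coef _ _ i).
      by rewrite zero submK // setU1K.
    apply: lst => [|k]; first exact: setU11.
    by rewrite !inE => /orP[/eqP->|->]; rewrite ?mi ?orbT.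
  case: ifP => mk; last by rewrite mulr0.
  have ik : (i < k)%N.
    by rewrite ltn_neqAle val_eqE eq_sym ki ile // mk orbT.
  (* the minimum of k |: C lies strictly above i, where m is nonzero *)
  rewrite /koszul_h; case: pickP => [j lj|_]; last by rewrite mcoeff0 mulr0.
  have ij : (i < j)%N.
    case/andP: lj; rewrite !inE => /orP[/eqP->//|jC] _.
    rewrite ltn_neqAle ile ?jC // andbT val_eqE; apply: contraNneq iC => ->.
  by [].
  have := @koszul_h_coef V (k |: C) j (m - U_(k)) lj; rewrite /koszul_h.
  case: pickP => [j' lj'|/(_ j)]; last by rewrite lj.
  rewrite (least_elt_uniq lj' lj) => ->; rewrite ifF ?mulr0 //.
  apply/negbTE/negP => /forallP/(_ i); rewrite ij /= mnmBE mnm1E (negbTE ki).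
  by rewrite subn0 (negbTE mi).
have miU : (m + U_(i))%MM i != 0%N by rewrite mnmDE mnm1E eqxx addn1.
rewrite koszul_d_coef [X in _ - X](bigD1 i) /=; last by rewrite !inE eqxx.
rewrite miU addmK setD1K // (_ : koszul_sign (C :\ i) i = 1); last first.
  by apply: koszul_sign_min => k; rewrite !inE => /andP[_ kC]; rewrite ile ?kC.
rewrite mul1r opprD addrA subrr add0r -sumrN.
apply: eq_big => [k|k kC].
  by rewrite !inE; case: (eqVneq k i) => [->|] //=; rewrite ?iC ?andbF ?andbT.
have ki : k != i by apply: contraNneq kC => ->.
rewrite mnmDE mnm1E [i == k]eq_sym (negbTE ki) addn0.
case: ifP => mk; last by rewrite !mulr0 oppr0.
have ik : (i < k)%N.
  by rewrite ltn_neqAle val_eqE eq_sym ki ile // mk orbT.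
rewrite (koszul_sign_least iC ik) mulNr; congr (- (_ * _)).
rewrite (@koszul_h_coef _ _ i); last first.
  apply: lst => [|l]; first by rewrite !inE iC orbT.
  by rewrite !inE => /orP[/eqP->|->]; rewrite ?mk ?orbT.
rewrite zero; congr (mcoeff _ _).
  by rewrite addmC addmBA ?lep1mP // addmC.
congr (V _); apply/setP=> l; rewrite !inE; case: (eqVneq l i) => [->|] //=.
by rewrite eq_sym (negbTE ki).
Qed.

(* Families indexed by the p-subsets, extended by 0 to all subsets. *)
Definition koszul_ext p (v : {ffun koszul_basis p -> S}) A : S :=
  if insub A is Some a then v a else 0.

Definition koszul_res p (V : {set 'I_n} -> S) : {ffun koszul_basis p -> S} :=
  [ffun a => V (val a)].

Lemma koszul_extE p (v : {ffun koszul_basis p -> S}) a :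
  koszul_ext v (val a) = v a.
Proof. by rewrite /koszul_ext valK. Qed.

Lemma koszul_ext_res p V A : #|A| = p -> koszul_ext (koszul_res p V) A = V A.
Proof.
move=> /eqP cA; rewrite /koszul_ext; case: insubP => [a _ <-|/negP//].
by rewrite ffunE.
Qed.

Lemma card_setU1_eq p C i : #|C| = p -> i \notin C -> #|i |: C| = p.+1.
Proof. by move=> <- iC; rewrite cardsU1 iC. Qed.

Lemma koszul_mapE p (v : {ffun koszul_basis p.+1 -> S}) (C : koszul_basis p) :
  free_map (@koszul_diff p) v C = koszul_d (koszul_ext v) (val C).
Proof.
rewrite ffunE /koszul_diff /koszul_d; have cC : #|val C| = p by apply/eqP/(valP C).
under eq_bigr => A _ do rewrite mulr_sumr.
rewrite (exchange_big_dep (fun i => i \notin val C)) /=; last first.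
  by move=> A i _ /andP[_ /eqP <-]; rewrite !inE eqxx.
apply: eq_bigr => i iC.
have /eqP cA := card_setU1_eq cC iC.
rewrite (big_pred1 (Sub (i |: val C) cA : koszul_basis p.+1)) => [|A].
  by rewrite -koszul_extE /= koszul_signU.
rewrite -[RHS](inj_eq val_inj) SubK; apply/andP/eqP => [[iA /eqP E]|->].
  by rewrite -[RHS]/(i |: sval C) -E setD1K.
by rewrite setU11 setU1K.
Qed.

Lemma koszul_d_ext p V C : #|C| = p -> koszul_d (koszul_ext (koszul_res p.+1 V)) C = koszul_d V C.
Proof.
move=> cC; apply: eq_bigr => i iC; rewrite koszul_ext_res //.
exact: card_setU1_eq.
Qed.

Lemma koszul_exact p (v : {ffun koszul_basis p.+1 -> S}) :
  free_map (@koszul_diff p) v = 0 <->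
  exists w : {ffun koszul_basis p.+2 -> S}, v = free_map (@koszul_diff p.+1) w.
Proof.
split=> [dv|[w ->]]; last first.
  apply/ffunP=> C; rewrite koszul_mapE [RHS]ffunE -[RHS](koszul_dd (koszul_ext w) (val C)).
  have cC : #|val C| = p by apply/eqP/(valP C).
  rewrite -(koszul_d_ext _ cC); apply: eq_bigr => i _; congr (koszul_ext _ _ * _).
  by apply/ffunP=> A; rewrite koszul_mapE ffunE.
exists (koszul_res p.+2 (koszul_h (koszul_ext v))); apply/ffunP=> C.
have cC : #|val C| = p.+1 by apply/eqP/(valP C).
rewrite koszul_mapE koszul_d_ext // -koszul_extE; apply/mpolyP=> m.
have [i0 i0C] : exists i, i \in val C by apply/card_gt0P; rewrite cC.
case: (@arg_minnP _ i0 (fun i => (i \in val C) || (m i != 0%N)) (@nat_of_ord n)).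
  by rewrite i0C.
move=> i iCm min; rewrite (@koszul_dh _ _ i) //; last first.
  move=> k ki; rewrite -[m k == _]negbK -negb_or.
  by apply: contraTN ki => /min; rewrite -leqNgt.
case: ifP => [iC|]; last by rewrite subr0.
have cD : #|val C :\ i| == p by have := cC; rewrite (cardsD1 i) iC add1n => /eqP; rewrite eqSS.
pose D : koszul_basis p := Sub (val C :\ i) cD.
have := koszul_mapE v D; rewrite dv ffunE /= => <-.
by rewrite mcoeff0 subr0.
Qed.

Lemma koszul_basis0 (a : koszul_basis 0) : val a = set0.
Proof. by apply/eqP; rewrite -cards_eq0; apply: (valP a). Qed.

Lemma card_koszul_basis0 : #|set0 : {set 'I_n}| == 0%N.
Proof. by rewrite cards0. Qed.

Lemma koszul_augE (v : {ffun koszul_basis 0 -> S}) :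
  augmentation (fun=> 1) v = (koszul_ext v set0)@_0%MM.
Proof.
pose a : koszul_basis 0 := Sub set0 card_koszul_basis0.
rewrite /augmentation (big_pred1 a) => [|b].
  by rewrite mulr1 -koszul_extE.
by apply/esym/eqP/val_inj; rewrite koszul_basis0.
Qed.

Lemma koszul_exact0 (v : {ffun koszul_basis 0 -> S}) :
  augmentation (fun=> 1) v = 0 <->
  exists w : {ffun koszul_basis 1 -> S}, v = free_map (@koszul_diff 0) w.
Proof.
rewrite koszul_augE; split=> [v0|[w ->]]; last first.
  have -> : koszul_ext (free_map (@koszul_diff 0) w) set0 =
            koszul_d (koszul_ext w) set0.
    pose a : koszul_basis 0 := Sub set0 card_koszul_basis0.
    by rewrite -[set0]/(val a) koszul_extE koszul_mapE.
  by rewrite koszul_d_coef big1 // => i _; rewrite mnm0E mulr0.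
exists (koszul_res 1 (koszul_h (koszul_ext v))); apply/ffunP=> C.
have cC : #|val C| = 0%N by apply/eqP/(valP C).
rewrite koszul_mapE koszul_d_ext // -koszul_extE koszul_basis0; apply/mpolyP=> m.
have [->|mn0] := eqVneq m 0%MM.
  by rewrite v0 koszul_d_coef big1 // => i _; rewrite mnm0E mulr0.
have [i0 i0m] : exists i, m i != 0%N.
  apply/existsP; apply: contraNT mn0; rewrite negb_exists => /forallP z.
  by apply/eqP/mnmP=> i; rewrite mnm0E; apply/eqP; rewrite -[_ == _]negbK.
case: (@arg_minnP _ i0 (fun i => m i != 0%N) (@nat_of_ord n)) => // i im min.
rewrite (@koszul_dh _ _ i) ?in_set0 ?subr0 ?im // => k ki; rewrite in_set0 /=.
by rewrite -[m k == _]negbK; apply: contraTN ki => /min; rewrite -leqNgt.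
Qed.

Lemma koszul_aug_surj (k : K) :
  exists v : {ffun koszul_basis 0 -> S}, augmentation (fun=> 1) v = k.
Proof.
exists (koszul_res 0 (fun=> k%:MP)).
by rewrite koszul_augE koszul_ext_res ?cards0 // mcoeffC eqxx mulr1.
Qed.

Lemma koszul_diff_homog p (A : koszul_basis p.+1) (C : koszul_basis p) :
  shifted_homog p p.+1 (koszul_diff A C).
Proof.
have : koszul_diff A C \is 1.-homog.
  by apply: rpred_sum => i _; apply: rpredZ; rewrite dhomogX /= mdeg1.
by move=> /dhomogP h m /h ->; rewrite add1n.
Qed.

Lemma koszul_aug_homog (a : koszul_basis 0) : (1 : K) != 0 -> 0 = 0%N.
Proof. by []. Qed.

Definition koszul_resolution : graded_free_resolution K n :=
  @GradedFreeResolution K n koszul_basis (fun p _ => p) koszul_diff (fun=> 1)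
    koszul_diff_homog koszul_aug_homog koszul_aug_surj koszul_exact0 koszul_exact.

End Koszul.

Section ComponentwiseLinear.
Variables (K : fieldType) (n : nat).
Local Notation S := {mpoly K[n]}.

(* beta_{p,q}(L) = b, i.e. dim_K Tor_p^S(K, L)_q = b *)
Definition graded_betti (L : S -> Prop) (p q b : nat) : Prop :=
  dim_quotient (@Tor_cycles K n (koszul_resolution K n) L p q)
               (@Tor_boundaries K n (koszul_resolution K n) L p q) b.

Definition linear_resolution (d : nat) (L : S -> Prop) : Prop :=
  generated_in_degree d L /\
  forall p q : nat, q <> (p + d)%N -> graded_betti L p q 0.

Definition componentwise_linear (I : S -> Prop) : Prop :=
  forall j, linear_resolution j (degree_part_ideal I j).

End ComponentwiseLinear.

(* Main.v *)
(* Everything happens in the Koszul complex, multidegree by multidegree. A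
   monomial m lies in L = I_<j> iff some d-set A satisfies a <= m on A and
   \sum_(i in A) a i <= j <= deg m.

   If a i1, a i2 > 1, choose a (d+1)-set C containing i1 and i2; let w be the
   monomial x_C^a and j = deg w - min (a i1) (a i2). Then
   (w/x_i1) e_i1 - (w/x_i2) e_i2 is a cycle over I_<j>; it is not a boundary,
   since no monomial w/(x_i1 x_l) lies in I. Its degree deg w is at least j + 2.

   If at most one a i exceeds 1, then in each multidegree w with deg w > p + j
   the p-cycles are coned off by a vertex i of the support of w: take i with
   w i <> a i if there is one, and otherwise i with a i maximal. If
   m = w/x_F with |F| = p and i not in F lies in L through a d-set A, then
   either A still works for m/x_i, or i can be exchanged in A for some k
   dividing m, with a k = 1, which exists because deg m > j. *)

Require Import Defs.
From mathcomp Require Import all_boot all_order all_algebra.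
From mathcomp Require Import zify.

Set Implicit Arguments.
Unset Strict Implicit.
Unset Printing Implicit Defensive.

Import GRing.Theory.

(** * Monomial ideals and their degree components *)

Section MonomialIdeals.
Local Open Scope ring_scope.
Variables (K : fieldType) (n : nat).
Local Notation S := {mpoly K[n]}.
Implicit Types (G I L : S -> Prop) (M N : 'X_{1..n} -> Prop) (f g : S).

Lemma ideal_gen_mem G g : G g -> ideal_gen G g.
Proof.
move=> Gg; exists [:: (1, g)] => [cg|]; last by rewrite big_seq1 mul1r.
by rewrite inE => /eqP ->.
Qed.

Lemma ideal_gen0 G : ideal_gen G 0.
Proof. by exists [::]; rewrite ?big_nil. Qed.

Lemma ideal_genD G f g : ideal_gen G f -> ideal_gen G g -> ideal_gen G (f + g).
Proof.
move=> [s sG ->] [t tG ->]; exists (s ++ t); last by rewrite big_cat.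
by move=> cg; rewrite mem_cat => /orP[/sG|/tG].
Qed.

Lemma ideal_genM G f g : ideal_gen G g -> ideal_gen G (f * g).
Proof.
move=> [s sG ->]; exists [seq (f * cg.1, cg.2) | cg <- s].
  by move=> _ /mapP[cg cgs ->]; exact: (sG cg cgs).
by rewrite mulr_sumr big_map; apply: eq_bigr => cg _; rewrite mulrA.
Qed.

Lemma ideal_gen_supp G f :
  (forall m, m \in msupp f -> ideal_gen G 'X_[m]) -> ideal_gen G f.
Proof.
move=> h; rewrite [f]mpolyE big_seq.
apply: big_ind => [|f1 f2|m /h]; [exact: ideal_gen0|exact: ideal_genD|].
by rewrite -mul_mpolyC; apply: ideal_genM.
Qed.

(** Every monomial surviving in [\sum c g] occurs in some product [c g], so it is a multiple of a
    monomial of [g]. *)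
Lemma ideal_gen_msupp G f m : ideal_gen G f -> m \in msupp f ->
  exists g u, [/\ G g, u \in msupp g & (u <= m)%MM].
Proof.
move=> [s sG ->]; rewrite mcoeff_msupp raddf_sum /=.
have [/hasP[cg cgs nz]|/hasPn z] := boolP (has (fun cg => (cg.1 * cg.2)@_m != 0) s).
  move=> _; move: nz; rewrite -mcoeff_msupp => /msuppM_le/allpairsP[[u1 u2] /=].
  move=> [_ u2g ->]; exists cg.2, u2; split=> //; first exact: sG.
  exact: lem_addl.
by rewrite big1_seq ?eqxx // => cg /andP[_ /z]; rewrite negbK => /eqP.
Qed.

Lemma ideal_monomialsP M f : ideal_gen (monomials M) f <->
  forall m, m \in msupp f -> exists2 u, M u & (u <= m)%MM.
Proof.
split=> [If m mf|h].
  have [g [u [[u' Mu' ->]]]] := ideal_gen_msupp If mf.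
  by rewrite msuppX inE => /eqP-> le; exists u'.
apply: ideal_gen_supp => m /h[u Mu le]; rewrite -(submK le) mpolyXD.
by apply: ideal_genM; apply: ideal_gen_mem; exists u.
Qed.

Lemma ideal_monomialsX M m :
  ideal_gen (monomials M) ('X_[m] : S) <-> exists2 u, M u & (u <= m)%MM.
Proof.
rewrite ideal_monomialsP; split=> [|h m']; first by apply; rewrite msuppX inE.
by rewrite msuppX inE => /eqP ->.
Qed.

Lemma mdeg_lepm (u v : 'X_{1..n}) : (u <= v)%MM -> (mdeg u <= mdeg v)%N.
Proof. by move=> /submK <-; rewrite mdegD leq_addl. Qed.

Lemma lepm_mdeg_eq (u v : 'X_{1..n}) : (u <= v)%MM -> mdeg u = mdeg v -> u = v.
Proof.
move=> uv e; rewrite -[LHS]add0m -[RHS](submK uv); congr (_ + _)%MM; apply/esym/eqP.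
by rewrite -mdeg_eq0 -(eqn_add2r (mdeg u)) -mdegD submK // e.
Qed.

Lemma mnm_between (u m : 'X_{1..n}) j : (u <= m)%MM ->
  (mdeg u <= j <= mdeg m)%N -> exists2 t, mdeg t = j & (u <= t)%MM && (t <= m)%MM.
Proof.
move=> um /andP[uj jm]; elim: j uj jm => [|j IH].
  by rewrite leqn0 => /eqP u0 _; exists u; rewrite ?lepm_refl.
rewrite leq_eqVlt => /predU1P[<- _|uj jm]; first by exists u; rewrite ?lepm_refl.
have [t tj /andP[ut tm]] := IH uj (ltnW jm).
have [i ti] : exists i, (t i < m i)%N.
  apply/existsP; apply: contraLR jm; rewrite negb_exists -leqNgt => /forallP h.
  rewrite -tj !mdegE; apply: leq_sum => i _; by have := h i; rewrite -leqNgt.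
exists (t + U_(i))%MM; first by rewrite mdegD mdeg1 tj addn1.
move: ut tm => /mnm_lepP ut /mnm_lepP tm.
apply/andP; split; apply/mnm_lepP => k; rewrite mnmDE mnm1E.
  exact: leq_trans (ut k) (leq_addr _ _).
by case: eqVneq => [<-|_]; rewrite ?addn1 // addn0.
Qed.

(** A monomial of the component is a multiple of a degree [j] monomial of the ideal; conversely
    [mnm_between] supplies such a monomial between [u] and [m]. *)
Lemma degree_part_monomialsP M j f :
  degree_part_ideal (ideal_gen (monomials M)) j f <->
  forall m, m \in msupp f ->
    exists2 u, M u & (u <= m)%MM && (mdeg u <= j <= mdeg m)%N.
Proof.
split=> [Lf m mf|h].
  have [g [t [[Ig /dhomogP hg] tg tm]]] := ideal_gen_msupp Lf mf.
  have [u Mu ut] := (ideal_monomialsP _ _).1 Ig t tg.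
  exists u => //; rewrite (lepm_trans ut tm) -(hg t tg) /=.
  by rewrite !mdeg_lepm.
apply: ideal_gen_supp => m /h[u Mu /andP[um uj]].
have [t tj /andP[ut tm]] := mnm_between um uj.
rewrite -(submK tm) mpolyXD; apply: ideal_genM; apply: ideal_gen_mem.
split; first by apply/ideal_monomialsX; exists u.
by rewrite dhomogX /= tj.
Qed.

(** Divisibility between monomials of equal degree is equality, so every monomial generating set
    contains [M], and [M] is irredundant. *)
Lemma min_gens_equidegree M d u : (forall u, M u -> mdeg u = d) ->
  min_gens (ideal_gen (monomials M) : S -> Prop) u <-> M u.
Proof.
move=> Md; have anti v w : M v -> M w -> (v <= w)%MM -> v = w.
  by move=> Mv Mw /lepm_mdeg_eq; apply; rewrite !Md.
split=> [[N [gN minN] Nu]|Mu].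
  apply: (minN M) Nu => // v Mv.
  have /gN/ideal_monomialsX[w Nw wv] : ideal_gen (monomials M) ('X_[v] : S).
    by apply/ideal_monomialsX; exists v; rewrite ?lepm_refl.
  have /gN/ideal_monomialsX[t Mt tw] : ideal_gen (monomials N) ('X_[w] : S).
    by apply/ideal_monomialsX; exists w; rewrite ?lepm_refl.
  have tv := anti _ _ Mt Mv (lepm_trans tw wv).
  rewrite -(lepm_mdeg_eq wv) //; apply/eqP; rewrite eqn_leq mdeg_lepm //=.
  by rewrite -tv mdeg_lepm.
exists M => //; split=> // M' sM gM' v Mv.
have /gM'/ideal_monomialsX[w M'w wv] : ideal_gen (monomials M) ('X_[v] : S).
  by apply/ideal_monomialsX; exists v; rewrite ?lepm_refl.
by rewrite -(anti w v) //; apply: sM.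
Qed.

End MonomialIdeals.

(** * Generators of the powered Veronese ideal *)

Section VeronesePowers.
Local Open Scope ring_scope.
Variables (K : fieldType) (n d : nat) (a : 'I_n -> nat).
Local Notation S := {mpoly K[n]}.
Local Notation I := (ideal_pow a (@squarefree_veronese K n d)).

(** For [#|A| = d] these are the exponents of the generators of [I], a squarefree monomial being
    coded by its support. *)
Definition mnm_on (A : {set 'I_n}) : 'X_{1..n} :=
  [multinom (if i \in A then a i else 0)%N | i < n].

Lemma mnm_on_le A m : (mnm_on A <= m)%MM <-> forall i, i \in A -> (a i <= m i)%N.
Proof.
split=> [/mnm_lepP h i iA|h]; first by have := h i; rewrite mnmE iA.
by apply/mnm_lepP => i; rewrite mnmE; case: ifP => // /h.
Qed.

Lemma mdeg_mnm_on A : mdeg (mnm_on A) = (\sum_(i in A) a i)%N.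
Proof. by rewrite mdegE [RHS]big_mkcond; apply: eq_bigr => i _; rewrite mnmE. Qed.

Lemma mnm_pow_squarefree w :
  (exists2 u, min_gens (@squarefree_veronese K n d) u & w = mnm_pow a u) <->
  (exists2 A : {set 'I_n}, #|A| = d & w = mnm_on A).
Proof.
pose M (u : 'X_{1..n}) := (forall i, (u i <= 1)%N) /\ mdeg u = d.
have gensE u : min_gens (@squarefree_veronese K n d) u <-> M u.
  exact: (@min_gens_equidegree K n M d u (fun v h => h.2)).
split=> [[u /gensE[u1 ud] ->]|[A Ad ->]].
  exists [set i | u i != 0%N].
    rewrite -ud mdegE -sum1_card big_mkcond; apply: eq_bigr => i _; rewrite inE.
    by have := u1 i; case: (u i) => [|[|]].
  apply/mnmP => i; rewrite !mnmE inE.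
  by have := u1 i; case: (u i) => [|[|]] //=; rewrite ?mul0n ?mul1n.
exists [multinom (i \in A : nat) | i < n].
  apply/gensE; split=> [i|]; first by rewrite mnmE leq_b1.
  rewrite mdegE -Ad -sum1_card [RHS]big_mkcond; apply: eq_bigr => i _.
  by rewrite mnmE; case: (i \in A).
by apply/mnmP => i; rewrite !mnmE; case: (i \in A); rewrite ?mul0n ?mul1n.
Qed.

Definition degree_part_mnm j (m : 'X_{1..n}) := exists A : {set 'I_n},
  [/\ #|A| = d, forall i, i \in A -> (a i <= m i)%N &
      (\sum_(i in A) a i <= j <= mdeg m)%N].

Lemma degree_part_powP j f : degree_part_ideal I j f <->
  forall m, m \in msupp f -> degree_part_mnm j m.
Proof.
rewrite degree_part_monomialsP; split=> h m /h.
  move=> [w /mnm_pow_squarefree[A Ad ->] /andP[/mnm_on_le le]].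
  by rewrite mdeg_mnm_on => dj; exists A.
move=> [A [Ad le dj]]; exists (mnm_on A); first by apply/mnm_pow_squarefree; exists A.
by rewrite mdeg_mnm_on dj andbT; apply/mnm_on_le.
Qed.

End VeronesePowers.

(** * A contracting homotopy of the Koszul complex with chosen vertices *)

Section KoszulHomotopy.
Local Open Scope ring_scope.
Variables (K : fieldType) (n : nat).
Local Notation S := {mpoly K[n]}.
Implicit Types (A C : {set 'I_n}) (m w : 'X_{1..n}) (V : {set 'I_n} -> S).

Definition set_mnm C : 'X_{1..n} := [multinom (i \in C : nat) | i < n].

Lemma mdeg_set_mnm C : mdeg (set_mnm C) = #|C|.
Proof.
rewrite mdegE -sum1_card [RHS]big_mkcond; apply: eq_bigr => i _.
by rewrite mnmE; case: (i \in C).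
Qed.

Lemma set_mnmU1 C i : i \notin C -> set_mnm (i |: C) = (U_(i) + set_mnm C)%MM.
Proof.
move=> iC; apply/mnmP => k; rewrite !mnmE !inE; case: (eqVneq k i) => [->|ki] /=.
  by rewrite (negbTE iC).
by [].
Qed.

Lemma set_mnmD1 C i : i \in C -> set_mnm C = (U_(i) + set_mnm (C :\ i))%MM.
Proof. by move=> iC; rewrite -set_mnmU1 ?setD1K // !inE eqxx. Qed.

Lemma koszul_sign_sq C i : koszul_sign K C i * koszul_sign K C i = 1.
Proof. by rewrite -expr2 -exprM mulnC exprM sqrrN !expr1n. Qed.

(** Only the sign of the larger index sees the smaller one, so the two orders of deleting [i] and
    inserting [k] differ by -1. This cancels the mixed terms of [d h] and [h d]. *)
Lemma koszul_sign_swap C (i k : 'I_n) : i \in C -> k \notin C ->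
  koszul_sign K C k * koszul_sign K (k |: C :\ i) i =
  - (koszul_sign K (C :\ i) i * koszul_sign K (C :\ i) k).
Proof.
move=> iC kC; have ki : k != i by apply: contraNneq kC => ->.
have kCi : k \notin C :\ i by rewrite !inE negb_and kC orbT.
move: ki; rewrite -val_eqE neq_ltn => /orP[ki|ik].
  rewrite (koszul_sign_least K (setU11 k _) ki) setU1K // (koszul_sign_gt _ _ ki).
  by rewrite mulrN mulrC.
rewrite (koszul_sign_least K iC ik) -(koszul_sign_gt K (k |: C :\ i) ik) setU1K //.
by rewrite mulNr mulrC.
Qed.

(** K-linear division by [x_i], dropping the monomials that fail [P] or are not divisible by
    [x_i]. *)
Definition div_var (P : pred 'X_{1..n}) (i : 'I_n) (f : S) : S :=
  \sum_(m <- msupp f) (if P m && (m i != 0%N) then f@_m *: 'X_[m - U_(i)] else 0).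

Lemma div_var_coef P i f m :
  (div_var P i f)@_m = if P (m + U_(i))%MM then f@_(m + U_(i)) else 0.
Proof.
pose mi := (m + U_(i))%MM; rewrite /div_var raddf_sum /= -/mi.
have E m' : (if P m' && (m' i != 0%N) then f@_m' *: 'X_[m' - U_(i)] else 0 : S)@_m =
    if m' == mi then (if P mi then f@_mi else 0) else 0.
  case: (eqVneq m' mi) => [->|ne].
    rewrite {2}/mi mnmDE mnm1E eqxx addn1 andbT; case: ifP => _; last exact: mcoeff0.
    by rewrite addmK mcoeffZ mcoeffX eqxx mulr1.
  case: ifP => [/andP[_ m'i]|_]; last exact: mcoeff0.
  rewrite mcoeffZ mcoeffX; case: eqVneq => [mE|]; last by rewrite mulr0.
  by case/eqP: ne; rewrite /mi -mE submK // lep1mP.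
rewrite (eq_bigr _ (fun m' _ => E m')) /=.
have [mif|mif] := boolP (mi \in msupp f).
  by rewrite (bigD1_seq mi) //= eqxx big1 ?addr0 // => m' /negbTE ->.
rewrite big1_seq ?(memN_msupp_eq0 mif) ?if_same // => m' /andP[_ m'f].
by case: eqP => // E'; rewrite -E' m'f in mif.
Qed.

Variable c : 'X_{1..n} -> 'I_n.

(* The multidegree of x^m e_A is m + set_mnm A; in multidegree w the homotopy
   sends x^m e_A to +- x^(m - U_i) e_(i |: A) with i = c w. *)
Definition cone_homotopy V A : S := \sum_(i in A)
  koszul_sign K (A :\ i) i *:
    div_var (fun m => c (m + set_mnm (A :\ i))%MM == i) i (V (A :\ i)).

Lemma cone_homotopy_coef V A m :
  let i := c (m + set_mnm A)%MM in
  (cone_homotopy V A)@_m =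
  if i \in A then koszul_sign K (A :\ i) i * (V (A :\ i))@_(m + U_(i)) else 0.
Proof.
move=> i; rewrite raddf_sum /=.
have E k : k \in A -> (koszul_sign K (A :\ k) k *:
    div_var (fun m => c (m + set_mnm (A :\ k))%MM == k) k (V (A :\ k)))@_m =
    if k == i then koszul_sign K (A :\ i) i * (V (A :\ i))@_(m + U_(i)) else 0.
  move=> kA; rewrite mcoeffZ div_var_coef -addmA -set_mnmD1 // -/i eq_sym.
  by case: eqVneq => [->|_]; rewrite ?mulr0.
rewrite (eq_bigr _ E); have [iA|iA] := boolP (i \in A).
  by rewrite (bigD1 i) //= eqxx big1 ?addr0 // => k /andP[_ /negbTE ->].
by rewrite big1 // => k kA; case: eqVneq => // ki; rewrite -ki kA in iA.
Qed.

(** This is [d h + h d = id] in each multidegree [w] with [x_(c w)] dividing [x^w]. Since [d] and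
    [h] preserve the multidegree, the vertex [i] is the same in all terms. *)
Lemma cone_homotopyP V C m : let i := c (m + set_mnm C)%MM in
  (m + set_mnm C)%MM i != 0%N ->
  (koszul_d (cone_homotopy V) C)@_m = (V C)@_m -
    (if i \in C then koszul_sign K (C :\ i) i * (koszul_d V (C :\ i))@_(m + U_(i))
     else 0).
Proof.
move=> i wi; rewrite koszul_d_coef.
have wE k : k \notin C -> m k != 0%N ->
    (m - U_(k) + set_mnm (k |: C))%MM = (m + set_mnm C)%MM.
  by move=> kC mk; rewrite set_mnmU1 // addmA submK // lep1mP.
have [iC|iC] := boolP (i \in C); last first.
  have mi : m i != 0%N by move: wi; rewrite mnmDE [set_mnm C i]mnmE (negbTE iC) addn0.
  have le : (U_(i) <= m)%MM by rewrite lep1mP.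
  (* Only the term inserting [i] survives, as [h] vanishes on sets avoiding the vertex. *)
  rewrite subr0 (bigD1 i) //= big1 => [|k /andP[kC ki]].
    rewrite mi cone_homotopy_coef wE // -/i setU11 setU1K // submK // mulrA.
    by rewrite koszul_sign_sq mul1r addr0.
  case: ifP => mk; last by rewrite mulr0.
  rewrite cone_homotopy_coef wE // -/i !inE (negbTE iC) orbF eq_sym (negbTE ki).
  by rewrite mulr0.
have miU : (m + U_(i))%MM i != 0%N by rewrite mnmDE mnm1E eqxx addn1.
(* The term [k = i] of [h d] gives back [V C]; the others are opposite to the terms of [d h]. *)
rewrite koszul_d_coef [X in _ * X](bigD1 i) /=; last by rewrite !inE eqxx.
rewrite miU addmK setD1K // mulrDr mulrA koszul_sign_sq mul1r.
rewrite opprD addrA subrr add0r mulr_sumr -sumrN.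
apply: eq_big => [k|k kC].
  by rewrite !inE; case: (eqVneq k i) => [->|] //=; rewrite ?iC ?andbF ?andbT.
have ki : k != i by apply: contraNneq kC => ->.
rewrite mnmDE mnm1E [i == k]eq_sym (negbTE ki) addn0.
case: ifP => mk; last by rewrite !mulr0 oppr0.
rewrite cone_homotopy_coef wE // -/i !inE iC orbT.
have -> : (k |: C) :\ i = k |: C :\ i.
  by apply/setP=> l; rewrite !inE; case: (eqVneq l k) => [->|] //=; rewrite ki.
rewrite !mulrA koszul_sign_swap // mulNr; congr (- (_ * _@_ _)).
by rewrite addmC addmBA ?lep1mP // addmC.
Qed.

(** A cycle satisfies [v = d (h v)], and the closure of [M] under division by the vertex keeps [h v]
    inside [M]. The cycle condition, put on sets with [#|C|.+1 = p], is empty for [p = 0]. *)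
Lemma koszul_boundary (M : 'X_{1..n} -> Prop) p q
    (v : {ffun koszul_basis n p -> S}) :
  q <> 0%N ->
  (forall w, w != 0%MM -> w (c w) != 0%N) ->
  (forall m A, #|A| = p -> (mdeg m + p)%N = q -> M m ->
     let i := c (m + set_mnm A)%MM in
     i \notin A -> M (m - U_(i))%MM) ->
  (forall b m, m \in msupp (v b) -> M m /\ (mdeg m + p)%N = q) ->
  (forall C, #|C|.+1 = p -> koszul_d (koszul_ext v) C = 0) ->
  exists2 u : {ffun koszul_basis n p.+1 -> S},
    v = free_map (@koszul_diff K n p) u &
    forall b m, m \in msupp (u b) -> M m /\ (mdeg m + p.+1)%N = q.
Proof.
move=> q0 cP Mc vM dv.
have extM A m : m \in msupp (koszul_ext v A) ->
    [/\ #|A| = p, M m & (mdeg m + p)%N = q].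
  rewrite /koszul_ext; case: insubP => [b /eqP bA _ /vM[Mm mq]|]; first by split.
  by rewrite msupp0.
exists (koszul_res p.+1 (cone_homotopy (koszul_ext v))); last first.
  move=> b m; rewrite ffunE mcoeff_msupp cone_homotopy_coef.
  set A := val b; set i := c _; case: ifP => iA; last by rewrite eqxx.
  rewrite mulf_eq0 negb_or => /andP[_]; rewrite -mcoeff_msupp => /extM[Ap Mm mq].
  split; last by move: mq; rewrite mdegD mdeg1 addn1 addSnnS.
  (* The source [x^(m + U_i) e_(A \ i)] has the multidegree of [x^m e_A], hence the same vertex. *)
  have := Mc _ _ Ap mq Mm; rewrite /= -addmA -set_mnmD1 // -/i addmK.
  by apply; rewrite !inE eqxx.
apply/ffunP => C; have cC : #|val C| = p by apply/eqP/(valP C).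
rewrite koszul_mapE koszul_d_ext // -koszul_extE; apply/mpolyP => m.
(* Multidegree 0 has no vertex, but a nonzero coefficient of [v] there would force [p = q = 0]. *)
have [/eqP w0|w0] := eqVneq (m + set_mnm (val C))%MM 0%MM.
  move: w0; rewrite -mdeg_eq0 mdegD mdeg_set_mnm addn_eq0 => /andP[].
  rewrite mdeg_eq0 => /eqP-> /eqP C0; rewrite koszul_d_coef big1.
    apply/eqP; rewrite mcoeff_eq0; apply/negP => /extM[_ _]; rewrite mdeg0 -cC C0.
    by move=> e; apply: q0.
  by move=> i _; rewrite mnm0E mulr0.
rewrite cone_homotopyP ?cP //; set i := c _; case: ifP => iC; last by rewrite subr0.
rewrite dv ?mcoeff0 ?mulr0 ?subr0 //.
by have := cC; rewrite (cardsD1 i) iC add1n.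
Qed.

End KoszulHomotopy.

(** * At most one exponent above 1: linear resolutions *)

Section Linearity.
Local Open Scope ring_scope.
Variables (K : fieldType) (n d : nat) (a : 'I_n -> nat).
Hypothesis a_gt0 : forall i, (0 < a i)%N.
Local Notation S := {mpoly K[n]}.
Local Notation I := (ideal_pow a (@squarefree_veronese K n d)).

Lemma graded_betti0 (L : S -> Prop) p q : graded_betti L p q 0 <->
  forall v, @Tor_cycles K n (koszul_resolution K n) L p q v ->
    @Tor_boundaries K n (koszul_resolution K n) L p q v.
Proof.
split=> [[t _ h] v /h[x [+ _]]|h]; first by rewrite big_ord0 subr0.
exists (fun=> 0) => [[]//|v /h Bv]; exists 0; split=> [|x _].
  by rewrite big_ord0 subr0.
by rewrite (thinmx0 x).
Qed.

(** The second alternative says that [w] is [mnm_on a B] for its support [B], with [a i] maximal on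
    [B]. *)
Definition cone_vertex (w : 'X_{1..n}) (i : 'I_n) : bool :=
  (w i != 0%N) && ((w i != a i) ||
    [forall k, (w k != 0%N) ==> ((w k == a k) && (a k <= a i)%N)]).

Lemma cone_vertex_exists w : w != 0%MM -> exists i, cone_vertex w i.
Proof.
move=> w0; have [i0 wi0] : exists i, w i != 0%N.
  apply/existsP; apply: contraNT w0; rewrite negb_exists => /forallP z.
  by apply/eqP/mnmP => i; rewrite mnm0E; apply/eqP; rewrite -[_ == _]negbK.
have [/existsP[i /andP[wi wa]]|/existsPn e] :=
    boolP [exists i, (w i != 0%N) && (w i != a i)].
  by exists i; rewrite /cone_vertex wi wa.
have [i wi mx] := @arg_maxnP _ i0 (fun i => w i != 0%N) a wi0.
exists i; rewrite /cone_vertex wi; apply/orP; right; apply/forallP => k.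
apply/implyP => wk; apply/andP; split; last exact: mx.
by have := e k; rewrite wk /= negbK.
Qed.

Hypothesis a_le1 : (#|[set i | 1 < a i]| <= 1)%N.

Lemma a_eq1 i k : (a k <= a i)%N -> k != i -> a k = 1%N.
Proof.
move=> aki ki; apply/eqP; rewrite eqn_leq a_gt0 andbT leqNgt.
apply: contraL a_le1 => ak; rewrite -ltnNge.
suff : (#|[set i; k]| <= #|[set i | 1 < a i]%N|)%N by rewrite cards2 eq_sym ki.
apply/subset_leq_card/subsetP => l; rewrite !inE => /orP[]/eqP->//.
exact: leq_trans aki.
Qed.

Lemma cone_vertexP j m (F : {set 'I_n}) i :
  (j < mdeg m)%N -> cone_vertex (m + set_mnm F) i -> i \notin F ->
  degree_part_mnm d a j m -> degree_part_mnm d a j (m - U_(i)).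
Proof.
move=> jm /andP[+ ci] iF [A [Ad Am /andP[Aj _]]].
have wE k : (m + set_mnm F)%MM k = (m k + (k \in F))%N by rewrite mnmDE mnmE.
have miE : (m + set_mnm F)%MM i = m i by rewrite wE (negbTE iF) addn0.
rewrite miE in ci *; move=> mi.
have jmi : (j <= mdeg (m - U_(i)))%N.
  have le : (U_(i) <= m)%MM by rewrite lep1mP.
  by move: jm; rewrite -{1}(submK le) mdegD mdeg1 addn1.
(* A [d]-set that works for [m], with strict inequality at [i] if it contains [i], still works after
   division by [x_i]. *)
have keep (B : {set 'I_n}) : (i \in B -> (a i < m i)%N) -> #|B| = d ->
    (forall k, k \in B -> (a k <= m k)%N) -> (\sum_(k in B) a k <= j)%N ->
    degree_part_mnm d a j (m - U_(i)).
  move=> Bi Bd Bm Bj; exists B; split=> //; last by rewrite Bj.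
  move=> k kB; rewrite mnmBE mnm1E; case: eqVneq => [ik|_]; last by rewrite subn0 Bm.
  by move: kB; rewrite -ik => /Bi; case: (m i) => // l; rewrite subn1.
have [iA|iA] := boolP (i \in A); last by apply: (keep A) => //; rewrite (negbTE iA).
have [mai|mai] := eqVneq (m i) (a i); last first.
  by apply: (keep A) => // _; rewrite ltn_neqAle eq_sym mai Am.
move: ci; rewrite mai eqxx /= => /forallP ci.
(* Here each [w k] is 0 or [a k], which bounds [m] by [a]. *)
have wa k : (m k <= a k)%N.
  have := ci k; rewrite wE; case: (eqVneq (m k + (k \in F))%N 0%N) => /= [|_].
    by move/eqP; rewrite addn_eq0 => /andP[/eqP->].
  by move=> /andP[/eqP <- _]; rewrite leq_addr.
(* If [m] were supported in [A], its degree would be at most the sum of [a] over [A], hence at most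
   [j]. *)
have [k kA mk] : exists2 k, k \notin A & m k != 0%N.
  apply/exists_inP; apply: contraLR jm => /exists_inPn h; rewrite -leqNgt.
  apply: leq_trans Aj; rewrite mdegE [X in (_ <= X)%N]big_mkcond; apply: leq_sum => k _.
  by case: ifP => [//|/negbT /h]; rewrite negbK => /eqP ->.
have ki : k != i by apply: contraNneq kA => ->.
have /andP[_ aki] : (m k + (k \in F) == a k)%N && (a k <= a i)%N.
  by have := ci k; rewrite wE addn_eq0 negb_and mk.
have ak := a_eq1 aki ki.
(* The exchange does not raise the generator degree since [a k <= a i], and [a k = 1] means that
   [x_k] dividing [x^m] suffices. *)
apply: (keep (k |: A :\ i)).
- by rewrite !inE eqxx eq_sym (negbTE ki).
- by rewrite cardsU1 !inE negb_and kA orbT -Ad [RHS](cardsD1 i) iA.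
- move=> l; rewrite !inE => /predU1P[->|/andP[_ /Am //]].
  by rewrite ak lt0n.
- rewrite big_setU1 ?inE ?negb_and ?kA ?orbT //=; apply: leq_trans Aj.
  by rewrite [X in (_ <= X)%N](big_setD1 i) //= leq_add2r.
Qed.

Lemma pow_componentwise_linear : (0 < n)%N -> componentwise_linear I.
Proof.
move=> n_gt0 j; split; first by exists (fun f => I f /\ f \is j.-homog) => // g [].
move=> p q pq; apply/graded_betti0 => v [vLq dv].
have LE f := @degree_part_powP K n d a j f.
have vM b m : m \in msupp (v b) -> degree_part_mnm d a j m /\ (mdeg m + p)%N = q.
  by move=> mv; have [/LE/(_ m mv) Mm /(_ m mv)] := vLq b.
(* Below the linear strand all chains vanish, as monomials of the component have degree at least
   [j]; above it the homotopy applies. *)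
have [qpj|pjq] : (q < p + j)%N \/ (p + j < q)%N by lia.
  have v0 : v = 0.
    apply/ffunP => b; rewrite [RHS]ffunE; apply/eqP; rewrite -msupp_eq0.
    case E : (msupp (v b)) => [//|m s]; have mv : m \in msupp (v b).
      by rewrite E mem_head.
    by have [[A [_ _ /andP[_ jm]]] mq] := vM b m mv; lia.
  exists 0 => [b|]; last first.
    rewrite v0; apply/ffunP => b; rewrite !ffunE big1 // => b' _.
    by rewrite ffunE mul0r.
  by split=> [|m]; [apply/LE => m|]; rewrite ffunE msupp0.
(* The default is reached only at [w = 0]. *)
pose c w := odflt (Ordinal n_gt0) [pick i | cone_vertex w i].
have cP w : w != 0%MM -> cone_vertex w (c w).
  by move=> /cone_vertex_exists[i wi]; rewrite /c; case: pickP => // /(_ i); rewrite wi.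
have [|w w0|m A Ap mq Mm i iA|C Cp|u vE uM] :=
    @koszul_boundary K n c (degree_part_mnm d a j) p q v _ _ _ vM _.
- by lia.
- by have /andP[] := cP w w0.
- apply: (cone_vertexP _ _ iA) => //; first by lia.
  apply: cP; rewrite -mdeg_eq0 mdegD mdeg_set_mnm Ap mq; lia.
- case: p v vLq dv vM pq pjq Cp => // p' v _ dv _ _ _ [Cp].
  have /eqP Cp' := Cp; pose C' : koszul_basis n p' := Sub C Cp'.
  by rewrite -[C]/(val C') -koszul_mapE [free_map _ _]dv ffunE.
exists u => // b; split=> [|m /uM[]//]; apply/LE => m /uM[]//.
Qed.

End Linearity.

(** * Two exponents above 1: a nonlinear syzygy *)

Section Nonlinearity.
Local Open Scope ring_scope.
Variables (K : fieldType) (n d : nat) (a : 'I_n -> nat).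
Hypothesis a_gt0 : forall i, (0 < a i)%N.
Local Notation S := {mpoly K[n]}.
Local Notation I := (ideal_pow a (@squarefree_veronese K n d)).

(** The exponents are below [a] at [i] and [l] and zero outside [C], so [A] would fit into [C] minus
    two elements, of size [d - 1]. *)
Lemma no_generator_below_sub2 (C A : {set 'I_n}) i l : #|C| = d.+1 ->
  i \in C -> l \in C -> l != i -> #|A| = d ->
  ~ (forall k, k \in A -> (a k <= (mnm_on a C - U_(i) - U_(l))%MM k)%N).
Proof.
move=> Cd iC lC li Ad h.
have : (#|A| <= #|C :\ i :\ l|)%N.
  apply/subset_leq_card/subsetP => k kA; have ak := a_gt0 k.
  have := h k kA; rewrite !mnmBE !mnm1E mnmE !inE ![_ == k]eq_sym.
  by case: (k == l); case: (k == i); case: (k \in C) => //=; lia.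
by move: Cd; rewrite (cardsD1 i) iC (cardsD1 l) !inE li lC Ad; lia.
Qed.

Lemma pow_not_componentwise_linear i1 i2 (C : {set 'I_n}) :
  (1 < a i1)%N -> (1 < a i2)%N -> i1 != i2 ->
  #|C| = d.+1 -> i1 \in C -> i2 \in C -> ~ componentwise_linear I.
Proof.
move=> a1 a2 i12 Cd i1C i2C lin.
(* Dropping [i] from [C] leaves a generator of degree [mdeg w - a i]; taking the minimum makes this
   at most [j] for both [i1] and [i2]. *)
pose w := mnm_on a C; pose e := minn (a i1) (a i2); pose j := (mdeg w - e)%N.
have sumD1 i : i \in C -> mdeg w = (a i + \sum_(k in C :\ i) a k)%N.
  by move=> iC; rewrite mdeg_mnm_on (big_setD1 i).
have jw : (1 < e <= mdeg w)%N.
  by rewrite (sumD1 i1 i1C) /e; lia.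
have Uw i : i \in C -> (U_(i) <= w)%MM.
  by move=> iC; rewrite lep1mP mnmE iC -lt0n.
have LE f := @degree_part_powP K n d a j f.
have LX i : i \in C -> (e <= a i)%N ->
    degree_part_ideal I j ('X_[w - U_(i)] : S).
  move=> iC ei; apply/LE => m; rewrite msuppX inE => /eqP ->; exists (C :\ i); split.
  - by apply: succn_inj; rewrite -Cd [RHS](cardsD1 i) iC.
  - move=> k; rewrite !inE => /andP[ki kC].
    by rewrite mnmBE mnm1E mnmE kC eq_sym (negbTE ki) subn0.
  have := congr1 mdeg (submK (Uw i iC)); rewrite mdegD mdeg1.
  by have := sumD1 i iC; rewrite /j; lia.
pose V (A : {set 'I_n}) : S := if A == [set i1] then 'X_[w - U_(i1)]
  else if A == [set i2] then - 'X_[w - U_(i2)] else 0.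
have [_ /(_ 1%N (mdeg w) _)/graded_betti0 betti] := lin j.
(* Because [e > 1], the degree of [w] is off the linear strand. *)
have ne : mdeg w <> (1 + j)%N by rewrite /j; lia.
have [|u uL vE] := betti ne (koszul_res 1 V).
  split; last first.
    apply/ffunP => D; rewrite [LHS]koszul_mapE [RHS]ffunE.
    have D0 := koszul_basis0 D; rewrite koszul_d_ext D0 ?cards0 //.
    rewrite /koszul_d (bigD1 i1) ?inE // (bigD1 i2) ?inE 1?eq_sym //=.
    rewrite big1 ?addr0 => [|k /andP[/andP[_ k1] k2]]; last first.
      rewrite /V setU0 !(inj_eq set1_inj) (negbTE k1) (negbTE k2).
      by rewrite mul0r.
    rewrite /V !setU0 eqxx (inj_eq set1_inj) eq_sym (negbTE i12) eqxx.
    have s1 i : koszul_sign K set0 i = 1.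
      by apply: koszul_sign_min => k; rewrite inE.
    by rewrite !s1 !scale1r mulNr -!mpolyXD !submK ?Uw // subrr.
  move=> b; rewrite ffunE /V; case: ifP => _; [|case: ifP => _].
  - split; first by apply: LX => //; exact: geq_minl.
    move=> m; rewrite msuppX inE => /eqP ->.
    by rewrite /= -{2}(submK (Uw i1 i1C)) mdegD mdeg1.
  - split.
      apply/LE => m; rewrite (perm_mem (msuppN _)).
      by apply/(LE 'X_[w - U_(i2)]): m; apply: LX => //; exact: geq_minr.
    move=> m; rewrite (perm_mem (msuppN _)) msuppX inE => /eqP ->.
    by rewrite /= -{2}(submK (Uw i2 i2C)) mdegD mdeg1.
  - by split; [apply/LE => m|move=> m]; rewrite msupp0.
have c1 : #|[set i1]| == 1%N by rewrite cards1.
pose b1 : koszul_basis n 1 := Sub [set i1] c1.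
(* At [e_i1] the cycle has coefficient 1 on [w/x_i1], whereas a boundary only collects coefficients
   on monomials [w/(x_i1 x_l)] with [l] in [C], none of which lies in the component. *)
have := congr1 (fun f : {ffun koszul_basis n 1 -> S} => (f b1)@_(w - U_(i1))) vE.
rewrite ffunE /V eqxx mcoeffX eqxx [free_map _ _ _]koszul_mapE koszul_d_coef.
rewrite big1 => [/eqP|l]; first by rewrite oner_eq0.
rewrite inE => li; case: ifP => wl; last by rewrite mulr0.
rewrite memN_msupp_eq0 ?mulr0 //; apply/negP; rewrite /koszul_ext.
case: insubP => [b _ _|]; last by rewrite msupp0.
have [/LE bL _ /bL[A [Ad Am _]]] := uL b.
have lC : l \in C.
  by move: wl; rewrite mnmBE mnm1E [i1 == l]eq_sym (negbTE li) subn0 mnmE; case: (l \in C).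
exact: no_generator_below_sub2 Cd i1C lC li Ad Am.
Qed.

End Nonlinearity.

(** * Choice of the set [C] and the equivalence *)

Lemma exists_superset_card (T : finType) (A : {set T}) m :
  #|A| <= m <= #|T| -> exists2 B : {set T}, A \subset B & #|B| = m.
Proof.
move=> /andP[Am mT]; elim: m Am mT => [|m IH].
  by rewrite leqn0 => /eqP A0 _; exists A.
rewrite leq_eqVlt => /predU1P[<- _|Am mT]; first by exists A.
have [B AB Bm] := IH Am (ltnW mT).
have [x xB] : exists x, x \notin B.
  apply/existsP; apply: contraLR mT; rewrite negb_exists -leqNgt -Bm => /forallP h.
  by apply/subset_leq_card/subsetP => x _; have := h x; rewrite negbK.
exists (x |: B); first exact: subset_trans AB (subsetUr _ _).
by rewrite cardsU1 xB Bm.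
Qed.

Theorem corollary2p4 (K : fieldType) (n d : nat) (hd : 2 <= d < n)
    (a : 'I_n -> nat) (ha : forall i, 0 < a i) :
  componentwise_linear (ideal_pow a (@squarefree_veronese K n d)) <->
  #|[set i | 1 < a i]| <= 1.
Proof.
have /andP[d2 dn] := hd.
split=> [lin|a1]; last by apply: pow_componentwise_linear => //; lia.
rewrite leqNgt; apply/negP => /card_gt1P[i1 [i2 []]]; rewrite !inE => a1 a2 i12.
(* There is room for [C] since [2 <= d.+1 <= n]. *)
have [C sub Cd] : exists2 C : {set 'I_n}, [set i1; i2] \subset C & #|C| = d.+1.
  by apply: exists_superset_card; rewrite cards2 i12 card_ord dn andbT; lia.
move: sub; rewrite subUset !sub1set => /andP[i1C i2C].
exact: (pow_not_componentwise_linear ha a1 a2 i12 Cd i1C i2C lin).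
Qed.
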